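(* Let $r\in\mathbb{R}$. For every integer $n\ge 0$, \[ B_n^{(r)}(x)=n!\sum_{k=0}^{n}\left\{\sum_{\substack{0\le l\le n-k\\ l\ \text{even}}}\frac{B_{n-k-l}^{(r)}}{k!\,(n-k-l)!\,2^{k+l}\,\left(\frac{l}{2}\right)!}\right\}H_k(x). \]
   Context: The Hermite polynomials $H_n(x)$ are defined by $e^{2xt-t^2}=\sum_{n\ge0}H_n(x)\frac{t^n}{n!}$. For $r\in\mathbb{R}$, the Bernoulli polynomials of order $r$ are defined by $\left(\frac{t}{e^t-1}\right)^r e^{xt}=\sum_{n\ge0}B_n^{(r)}(x)\frac{t^n}{n!}$, and the Bernoulli numbers of order $r$ are $B_n^{(r)}=B_n^{(r)}(0)$. *)

(* Defs.v *)
(* Stdlib reals with Coquelicot. *)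
From Stdlib Require Import Reals Factorial ClassicalEpsilon.
From Coquelicot Require Import Coquelicot.
Open Scope R_scope.

(* F(t) = sum_n a_n t^n / n! near t = 0.  The point t = 0 itself is left out,
   so that F may have a removable singularity there; a is still determined
   by F. *)
Definition is_egf (F : R -> R) (a : nat -> R) : Prop :=
  locally' 0 (fun t => is_pseries (fun n => a n / INR (fact n)) t (F t)).

(* Meaningful only when F has such an expansion, as the two functions below
   do for all values of their parameters. *)
Definition egf_coeff (F : R -> R) : nat -> R :=
  epsilon (inhabits (fun _ : nat => 0)) (is_egf F).

Definition hermite (n : nat) (x : R) : R :=
  egf_coeff (fun t => exp (2 * x * t - t ^ 2)) n.

(* Rpower is the real power of a positive base: t / (e^t - 1) > 0 for t <> 0. *)
Definition bernoulli_poly (r : R) (n : nat) (x : R) : R :=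
  egf_coeff (fun t => Rpower (t / (exp t - 1)) r * exp (x * t)) n.

Definition bernoulli_number (r : R) (n : nat) : R := bernoulli_poly r n 0.

(* Main.v *)
(* Writing G(t) = (t / (e^t - 1))^r, the generating function of B_n^(r)(x) is
     G(t) e^(xt) = e^(2x(t/2) - (t/2)^2) e^(t^2/4) G(t),
   a product of the generating function of H_k(x) at t/2, an even Gaussian
   series and the generating function of B_n^(r); the theorem compares the
   coefficients of t^n.  What has to be proved is that G is analytic at 0:
   with A(t) = (e^t - 1)/t and s = -r, the equation A B' = s A' B determines
   the coefficients of B = A^s recursively, and they grow at most
   geometrically because those of A are at most 1 in absolute value. *)
Require Import Defs.
From Stdlib Require Import Reals Factorial.
From Coquelicot Require Import Coquelicot.
From Stdlib Require Import Lra Lia ClassicalEpsilon.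
Open Scope R_scope.

(** * Power series expansions on a punctured neighbourhood of 0 *)

(** Plain coefficients, without the factorials of [is_egf], so that products of functions become
    Cauchy products. *)
Definition has_expansion (F : R -> R) (a : nat -> R) : Prop :=
  locally' 0 (fun t => is_pseries a t (F t)).

Lemma has_expansion_global (F : R -> R) (a : nat -> R) :
  (forall t, is_pseries a t (F t)) -> has_expansion F a.
Proof.
intros H; exists (mkposreal 1 Rlt_0_1); intros t _ _; apply H.
Qed.

Lemma has_expansion_ext (F G : R -> R) (a : nat -> R) :
  (forall t, t <> 0 -> F t = G t) -> has_expansion F a -> has_expansion G a.
Proof.
intros E [d H]; exists d; intros t Ht Ht0.
rewrite <- (E t Ht0); now apply H.
Qed.

(** The series converges at the nonzero point [d / 2], which would lie outside the disk of
    convergence if the radius were not positive. *)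
Lemma has_expansion_radius (F : R -> R) (a : nat -> R) :
  has_expansion F a -> Rbar_lt 0 (CV_radius a).
Proof.
intros [d H].
assert (Hd := cond_pos d).
destruct (Rbar_lt_le_dec 0 (CV_radius a)) as [Hr | Hr]; [exact Hr | exfalso].
assert (Ht : is_pseries a (d / 2) (F (d / 2))).
{ apply H; [|lra].
  change (Rabs (d / 2 - 0) < d); rewrite Rabs_pos_eq; lra. }
apply (CV_disk_outside a (d / 2)).
- apply Rbar_le_lt_trans with 0; [exact Hr|].
  simpl; rewrite Rabs_pos_eq; lra.
- apply ex_series_lim_0; exists (F (d / 2)); now apply is_pseries_R.
Qed.

(* Multiplying both series by t makes them agree at t = 0 as well. *)
Lemma has_expansion_unique (F : R -> R) (a b : nat -> R) :
  has_expansion F a -> has_expansion F b -> forall n, a n = b n.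
Proof.
intros Ha Hb n.
change (a n) with (PS_incr_1 a (S n)).
change (b n) with (PS_incr_1 b (S n)).
apply PSeries_ext_recip;
  try (rewrite CV_radius_incr_1; eapply has_expansion_radius; eassumption).
destruct (filter_and _ _ Ha Hb) as [d H]; exists d; intros t Ht.
rewrite 2!PSeries_incr_1.
destruct (Req_dec t 0) as [-> | Ht0]; [ring|].
destruct (H t Ht Ht0) as [Hat Hbt].
now rewrite (is_pseries_unique _ _ _ Hat), (is_pseries_unique _ _ _ Hbt).
Qed.

Lemma locally_lt_Rbar (c : Rbar) :
  Rbar_lt 0 c -> locally 0 (fun t : R => Rbar_lt (Rabs t) c).
Proof.
intros Hc; destruct c as [c | |]; try easy.
- exists (mkposreal c Hc); intros t Ht.
  change (Rabs (t - 0) < c) in Ht; now rewrite Rminus_0_r in Ht.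
- now exists (mkposreal 1 Rlt_0_1).
Qed.

(** The Cauchy product is taken strictly inside both disks of convergence, hence the smaller
    neighbourhood. *)
Lemma has_expansion_mult (F G : R -> R) (a b : nat -> R) :
  has_expansion F a -> has_expansion G b ->
  has_expansion (fun t => F t * G t) (PS_mult a b).
Proof.
intros Ha Hb.
generalize (filter_and _ _ Ha Hb), (filter_and _ _
  (locally_lt_Rbar _ (has_expansion_radius _ _ Ha))
  (locally_lt_Rbar _ (has_expansion_radius _ _ Hb))).
intros H [d1 H1]; destruct H as [d2 H2].
exists (mkposreal _ (Rmin_stable_in_posreal d1 d2)); intros t Ht Ht0.
destruct (H1 t) as [HA HB].
{ eapply Rlt_le_trans; [exact Ht | apply Rmin_l]. }
destruct (H2 t) as [HF HG]; [|exact Ht0|].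
{ eapply Rlt_le_trans; [exact Ht | apply Rmin_r]. }
now apply is_pseries_mult.
Qed.

Lemma is_pseries_scale (a : nat -> R) (c t l : R) :
  is_pseries a (c * t) l -> is_pseries (fun n => c ^ n * a n) t l.
Proof.
rewrite 2!is_pseries_R; apply is_series_ext; intros n.
rewrite Rpow_mult_distr; simpl; ring.
Qed.

Lemma has_expansion_half (F : R -> R) (a : nat -> R) :
  has_expansion F a ->
  has_expansion (fun t => F (/ 2 * t)) (fun n => (/ 2) ^ n * a n).
Proof.
intros [d H]; exists d; intros t Ht Ht0.
apply is_pseries_scale, H; [|lra].
change (Rabs (t - 0) < d) in Ht; change (Rabs (/ 2 * t - 0) < d).
rewrite Rminus_0_r in *; rewrite Rabs_mult, (Rabs_pos_eq (/ 2)) by lra.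
assert (H0 := Rabs_pos t); lra.
Qed.

(** * Exponential and Gaussian series *)

Lemma has_expansion_exp (c : R) :
  has_expansion (fun t => exp (c * t)) (fun n => c ^ n * / INR (fact n)).
Proof.
apply has_expansion_global; intros t.
apply is_pseries_scale, is_exp_Reals.
Qed.

Definition gauss_coeff (c : R) (n : nat) : R :=
  if Nat.even n then c ^ Nat.div2 n * / INR (fact (Nat.div2 n)) else 0.

Lemma has_expansion_gauss (c : R) :
  has_expansion (fun t => exp (c * t ^ 2)) (gauss_coeff c).
Proof.
apply has_expansion_global; intros t.
(* The odd part is the zero series; [t * 0] gives the value the shape of an even plus an odd
   part. *)
replace (exp (c * t ^ 2)) with (exp (c * t ^ 2) + t * 0) by ring.
apply is_pseries_odd_even.
- eapply is_pseries_ext; [|apply is_pseries_scale, is_exp_Reals].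
  intros n; unfold gauss_coeff.
  now rewrite Nat.div2_double, Nat.even_mul.
- apply is_pseries_ext with (fun _ => 0).
  + intros n; unfold gauss_coeff.
    now rewrite Nat.add_comm, Nat.even_add_mul_2.
  + assert (Z : is_pseries (fun _ => 0) (t ^ 2) (PSeries (fun _ => 0) (t ^ 2))).
    { apply PSeries_correct, CV_radius_inside.
      now rewrite CV_radius_const_0. }
    rewrite PSeries_const_0 in Z; exact Z.
Qed.

(** * Real powers of a power series *)

Lemma course_of_values (G : nat -> (nat -> R) -> R) (v : R) :
  (forall n u w, (forall k, (k <= n)%nat -> u k = w k) -> G n u = G n w) ->
  exists b : nat -> R, b 0%nat = v /\ forall n, b (S n) = G n b.
Proof.
intros HG.
(* [f n] is correct at indices up to [n] and arbitrary beyond; by [HG] the arbitrary values are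
   never read, so the diagonal is the wanted sequence. *)
pose (f := fix f (n : nat) : nat -> R :=
  match n with
  | 0%nat => fun _ => v
  | S m => fun k => if Nat.leb k m then f m k else G m (f m)
  end).
assert (fS : forall m k,
  f (S m) k = if Nat.leb k m then f m k else G m (f m)) by reflexivity.
assert (Hf : forall n k, (k <= n)%nat -> f n k = f k k).
{ induction n as [|n IH]; intros k Hk.
  - now replace k with 0%nat by lia.
  - destruct (Nat.eq_dec k (S n)) as [-> | Hne]; [reflexivity|].
    rewrite fS, (proj2 (Nat.leb_le k n)) by lia; apply IH; lia. }
exists (fun n => f n n); split; [reflexivity|]; intros n.
rewrite fS, (proj2 (Nat.leb_gt (S n) n)) by lia.
apply HG, Hf.
Qed.

(** Bounds growing with ratio [1 + S0] absorb the sum of all earlier bounds weighted by [S0]; this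
    closes the induction in [power_coeff_bound]. *)
Lemma geometric_sum (S0 : R) (n : nat) :
  sum_f_R0 (fun j => S0 * (1 + S0) ^ (n - j)) n = (1 + S0) ^ S n - 1.
Proof.
induction n as [|n IH]; [simpl; ring|].
rewrite decomp_sum by lia; simpl pred.
rewrite (sum_eq _ (fun j => S0 * (1 + S0) ^ (n - j))).
- rewrite IH, Nat.sub_0_r; simpl; ring.
- intros; reflexivity.
Qed.

(* The recursion is the coefficient form of [A B' = s A' B], solved for the
   top coefficient of [B] using [a 0 = 1]. *)
Lemma power_coeff_exists (a : nat -> R) (s : R) :
  exists b : nat -> R, b 0%nat = 1 /\ forall n,
    INR (S n) * b (S n) =
    sum_f_R0 (fun j => a (S j) * (s * INR (S j) - INR (n - j)) * b (n - j)%nat) n.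
Proof.
destruct (course_of_values (fun n b => / INR (S n) *
  sum_f_R0 (fun j => a (S j) * (s * INR (S j) - INR (n - j)) * b (n - j)%nat) n)
  1) as [b [H0 HS]].
- intros n u w H; f_equal; apply sum_eq; intros j _; rewrite H; [ring | lia].
- exists b; split; [exact H0|]; intros n; rewrite HS.
  field; apply not_0_INR; lia.
Qed.

(** Strong induction: each factor [s * (j + 1) - (n - j)] is at most [(1 + |s|) * (n + 1)] in
    absolute value, so [n + 1] cancels and a geometric sum remains. *)
Lemma power_coeff_bound (a b : nat -> R) (s : R) :
  (forall n, Rabs (a n) <= 1) -> b 0%nat = 1 ->
  (forall n, INR (S n) * b (S n) =
    sum_f_R0 (fun j => a (S j) * (s * INR (S j) - INR (n - j)) * b (n - j)%nat) n) ->
  forall n, Rabs (b n) <= (1 + (1 + Rabs s)) ^ n.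
Proof.
intros Ha H0 HS.
assert (Hs := Rabs_pos s); set (M := 1 + Rabs s).
induction n as [n IH] using (well_founded_induction Wf_nat.lt_wf).
destruct n as [|n]; [rewrite H0, Rabs_R1; simpl; lra|].
assert (Hn : 0 < INR (S n)) by (apply lt_0_INR; lia).
apply Rmult_le_reg_l with (INR (S n)); [exact Hn|].
rewrite <- (Rabs_pos_eq (INR (S n))) at 1 by lra.
rewrite <- Rabs_mult, HS.
eapply Rle_trans; [apply sum_f_R0_triangle|].
apply Rle_trans with
  (sum_f_R0 (fun j => M * (1 + M) ^ (n - j) * INR (S n)) n).
- apply sum_Rle; intros j Hj.
  rewrite 2!Rabs_mult.
  assert (Hb : Rabs (b (n - j)%nat) <= (1 + M) ^ (n - j)) by (apply IH; lia).
  assert (Hc : Rabs (s * INR (S j) - INR (n - j)) <= M * INR (S n)).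
  { assert (E : INR (S n) = INR (S j) + INR (n - j)).
    { rewrite <- plus_INR; f_equal; lia. }
    assert (P1 := pos_INR (S j)); assert (P2 := pos_INR (n - j)).
    unfold Rminus; eapply Rle_trans; [apply Rabs_triang|].
    rewrite Rabs_mult, Rabs_Ropp, 2!(Rabs_pos_eq (INR _)) by assumption.
    rewrite E; unfold M; nra. }
  assert (Ha' := Ha (S j)).
  assert (Q1 := Rabs_pos (a (S j))).
  assert (Q2 := Rabs_pos (s * INR (S j) - INR (n - j))).
  assert (Q3 := Rabs_pos (b (n - j)%nat)).
  replace (M * (1 + M) ^ (n - j) * INR (S n))
    with (1 * (M * INR (S n)) * (1 + M) ^ (n - j)) by ring.
  repeat apply Rmult_le_compat; try assumption; now apply Rmult_le_pos.
- rewrite <- scal_sum, geometric_sum; apply Rmult_le_compat_l; lra.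
Qed.

Lemma radius_ge_of_geometric (a : nat -> R) (c : R) :
  0 < c -> (forall n, Rabs (a n) <= c ^ n) -> Rbar_le (/ c) (CV_radius a).
Proof.
intros Hc Ha; apply CV_radius_bounded; exists 1; intros n.
rewrite Rabs_mult, (Rabs_pos_eq ((/ c) ^ n)).
- replace 1 with (c ^ n * (/ c) ^ n).
  + apply Rmult_le_compat_r; [|apply Ha].
    apply pow_le, Rlt_le, Rinv_0_lt_compat, Hc.
  + rewrite <- Rpow_mult_distr, Rinv_r by lra; apply pow1.
- apply pow_le, Rlt_le, Rinv_0_lt_compat, Hc.
Qed.

(** The term [k = 0] of [A B'] is [(n + 1) * b (n + 1)] since [a 0 = 1]; after expanding it by the
    recursion, the remaining terms cancel those with [INR (n - j)]. *)
Lemma power_coeff_ode (a b : nat -> R) (s : R) :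
  a 0%nat = 1 ->
  (forall n, INR (S n) * b (S n) =
    sum_f_R0 (fun j => a (S j) * (s * INR (S j) - INR (n - j)) * b (n - j)%nat) n) ->
  forall n, PS_mult a (PS_derive b) n = s * PS_mult (PS_derive a) b n.
Proof.
intros Ha HS n; unfold PS_mult, PS_derive.
assert (E : sum_f_R0 (fun k => a k * (INR (S (n - k)) * b (S (n - k)))) n =
  INR (S n) * b (S n) +
  sum_f_R0 (fun j => a (S j) * INR (n - j) * b (n - j)%nat) n).
{ destruct n as [|n].
  - simpl sum_f_R0; rewrite Ha; simpl; ring.
  - rewrite decomp_sum by lia; simpl pred.
    rewrite Ha, Nat.sub_0_r, Rmult_1_l; f_equal.
    (* The last term, [j = S n], vanishes through its factor [INR 0]. *)
    rewrite (tech5 _ n), Nat.sub_diag; simpl (INR 0).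
    rewrite Rmult_0_r, Rmult_0_l, Rplus_0_r.
    apply sum_eq; intros j Hj.
    replace (S n - S j)%nat with (n - j)%nat by lia.
    replace (S n - j)%nat with (S (n - j)) by lia; ring. }
rewrite E, HS, <- plus_sum, scal_sum.
apply sum_eq; intros j _; ring.
Qed.

(* [PSeries b * (PSeries a) ^ (- s)] has derivative zero and value 1 at 0. *)
Lemma is_pseries_Rpower (a : nat -> R) (s : R) :
  a 0%nat = 1 -> (forall n, Rabs (a n) <= 1) ->
  exists b, locally 0 (fun t => is_pseries b t (Rpower (PSeries a t) s)).
Proof.
intros Ha0 Ha.
destruct (power_coeff_exists a s) as [b [Hb0 HS]]; exists b.
assert (Hode := power_coeff_ode a b s Ha0 HS).
assert (Hra : Rbar_lt 0 (CV_radius a)).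
{ apply Rbar_lt_le_trans with (/ 1); [simpl; lra|].
  apply radius_ge_of_geometric; [lra|].
  intros n; rewrite pow1; apply Ha. }
assert (Hrb : Rbar_lt 0 (CV_radius b)).
{ assert (Hs := Rabs_pos s).
  apply Rbar_lt_le_trans with (/ (1 + (1 + Rabs s))).
  - apply Rinv_0_lt_compat; lra.
  - apply radius_ge_of_geometric; [lra|].
    now apply (power_coeff_bound a b s). }
(* Positivity near 0 makes [ln (PSeries a t)] differentiable there. *)
assert (Hpos : locally 0 (fun t => 0 < PSeries a t)).
{ assert (Hc : continuous (PSeries a) 0).
  { apply continuity_pt_filterlim, PSeries_continuity.
    now rewrite Rabs_R0. }
  apply (Hc (fun y => 0 < y)); rewrite PSeries_0, Ha0.
  apply (open_gt 0); lra. }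
destruct (filter_and _ _ Hpos (filter_and _ _
  (locally_lt_Rbar _ Hra) (locally_lt_Rbar _ Hrb))) as [d H].
set (A := PSeries a) in *; set (B := PSeries b).
assert (HD : forall t, Rabs t < d ->
  is_derive (fun u => B u * exp (- s * ln (A u))) t 0).
{ intros t Ht.
  destruct (H t) as [HA [Hta Htb]].
  { change (Rabs (t - 0) < d); now rewrite Rminus_0_r. }
  assert (DA := is_derive_PSeries a t Hta).
  assert (DB := is_derive_PSeries b t Htb).
  assert (E : A t * PSeries (PS_derive b) t = s * (PSeries (PS_derive a) t * B t)).
  { unfold A, B; rewrite <- 2!PSeries_mult by now rewrite ?CV_radius_derive.
    rewrite <- PSeries_scal; apply PSeries_ext; exact Hode. }
  fold A in DA; fold B in DB.
  auto_derive.
  - repeat split; try assumption; eexists; eassumption.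
  - change (Derive (fun x => A x) t) with (Derive A t).
    change (Derive (fun x => B x) t) with (Derive B t).
    rewrite (is_derive_unique _ _ _ DA), (is_derive_unique _ _ _ DB).
    apply Rmult_eq_reg_l with (A t); [|lra].
    (* [A t] times the derivative is the defect [A B' - s A' B] of the differential equation, times
       the exponential. *)
    transitivity ((A t * PSeries (PS_derive b) t
      - s * (PSeries (PS_derive a) t * B t)) * exp (- s * ln (A t)));
      [field; lra | rewrite E; ring]. }
assert (HB : forall t, Rabs t < d -> B t * exp (- s * ln (A t)) = 1).
{ assert (H1 : B 0 * exp (- s * ln (A 0)) = 1).
  { unfold A, B; rewrite 2!PSeries_0, Ha0, Hb0, ln_1, Rmult_0_r, exp_0; ring. }
  intros t Ht; rewrite <- H1.
  apply Rabs_def2 in Ht.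
  destruct (Rtotal_order t 0) as [Hlt | [-> | Hgt]]; [|reflexivity|].
  - apply (eq_is_derive (fun u => B u * exp (- s * ln (A u)))); [|lra].
    intros u Hu; apply HD, Rabs_def1; lra.
  - symmetry; apply (eq_is_derive (fun u => B u * exp (- s * ln (A u)))); [|lra].
    intros u Hu; apply HD, Rabs_def1; lra. }
exists d; intros t Ht.
destruct (H t Ht) as [HA [Hta Htb]].
change (Rabs (t - 0) < d) in Ht; rewrite Rminus_0_r in Ht.
replace (Rpower (A t) s) with (B t).
- apply PSeries_correct, CV_radius_inside, Htb.
- unfold Rpower; apply Rmult_eq_reg_r with (exp (- s * ln (A t))).
  + rewrite (HB t Ht), <- exp_plus, <- exp_0; f_equal; ring.
  + apply Rgt_not_eq, exp_pos.
Qed.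

(** * The generating function of the Bernoulli numbers of order [r] *)

Lemma expm1_div_pos (t : R) : t <> 0 -> 0 < (exp t - 1) / t.
Proof.
intros Ht; destruct (Rdichotomy _ _ Ht) as [H | H].
- assert (E : exp t < exp 0) by (now apply exp_increasing); rewrite exp_0 in E.
  replace ((exp t - 1) / t) with ((1 - exp t) / (- t)) by (field; lra).
  apply Rdiv_lt_0_compat; lra.
- assert (E : exp 0 < exp t) by (now apply exp_increasing); rewrite exp_0 in E.
  apply Rdiv_lt_0_compat; lra.
Qed.

Lemma PSeries_expm1_div (t : R) :
  t <> 0 -> PSeries (fun n => / INR (fact (S n))) t = (exp t - 1) / t.
Proof.
intros Ht.
assert (E := PSeries_decr_1 _ t (ex_intro _ _ (is_exp_Reals t))).
rewrite (is_pseries_unique _ _ _ (is_exp_Reals t)) in E.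
change (PSeries (fun n => / INR (fact (S n))) t)
  with (PSeries (PS_decr_1 (fun n => / INR (fact n))) t).
rewrite E; simpl (fact 0); simpl (INR 1); field; exact Ht.
Qed.

(** [t / (e^t - 1)] is the inverse of a series with constant term 1 and coefficients [1 / (n + 1)!],
    all at most 1, so its power [r] is the power [- r] of that series. *)
Lemma has_expansion_bernoulli (r : R) :
  exists b, has_expansion (fun t => Rpower (t / (exp t - 1)) r) b.
Proof.
destruct (is_pseries_Rpower (fun n => / INR (fact (S n))) (- r)) as [b [d Hb]].
- simpl; field.
- intros n; rewrite Rabs_pos_eq.
  + rewrite <- Rinv_1; apply Rinv_le_contravar; [lra|].
    apply (le_INR 1), lt_O_fact.
  + apply Rlt_le, Rinv_0_lt_compat, INR_fact_lt_0.
- exists b; exists d; intros t Ht Ht0.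
  replace (Rpower (t / (exp t - 1)) r)
    with (Rpower (PSeries (fun n => / INR (fact (S n))) t) (- r));
    [exact (Hb t Ht)|].
  rewrite (PSeries_expm1_div t Ht0).
  assert (P := expm1_div_pos t Ht0).
  assert (exp t - 1 <> 0).
  { intros E; rewrite E in P; unfold Rdiv in P; lra. }
  replace (t / (exp t - 1)) with (/ ((exp t - 1) / t)) by (now field).
  unfold Rpower; rewrite ln_Rinv by exact P; f_equal; ring.
Qed.

(** * Comparison of the generating functions *)

(** [epsilon] returns a valid sequence once one exists, and [b n * n!] is one. *)
Lemma egf_coeff_spec (F : R -> R) (b : nat -> R) :
  has_expansion F b ->
  has_expansion F (fun n => egf_coeff F n / INR (fact n)).
Proof.
intros [d H]; apply (epsilon_spec (inhabits (fun _ : nat => 0)) (is_egf F)).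
exists (fun n => b n * INR (fact n)); exists d; intros t Ht Ht0.
eapply is_pseries_ext; [|exact (H t Ht Ht0)]; intros n; simpl.
field; apply INR_fact_neq_0.
Qed.

Lemma has_expansion_hermite (x : R) :
  has_expansion (fun t => exp (2 * x * t - t ^ 2))
    (fun n => hermite n x / INR (fact n)).
Proof.
eapply egf_coeff_spec.
eapply has_expansion_ext;
  [|exact (has_expansion_mult _ _ _ _
      (has_expansion_exp (2 * x)) (has_expansion_gauss (- 1)))].
intros t _; simpl; rewrite <- exp_plus; f_equal; ring.
Qed.

Lemma has_expansion_bernoulli_poly (r x : R) :
  has_expansion (fun t => Rpower (t / (exp t - 1)) r * exp (x * t))
    (fun n => bernoulli_poly r n x / INR (fact n)).
Proof.
destruct (has_expansion_bernoulli r) as [b Hb].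
eapply egf_coeff_spec.
exact (has_expansion_mult _ _ _ _ Hb (has_expansion_exp x)).
Qed.

(** Turns the Gaussian factor [4^(-l/2)] into [2^(-l)], which joins the [2^(-k)] of
    [has_expansion_half] to form [2^(k+l)]. *)
Lemma pow_quarter_div2 (l : nat) :
  Nat.even l = true -> (/ 4) ^ Nat.div2 l = / 2 ^ l.
Proof.
intros H; apply Nat.even_spec in H; destruct H as [m ->].
rewrite Nat.div2_double, pow_mult, <- pow_inv; f_equal; simpl; field.
Qed.

Theorem theorem2 (r : R) (n : nat) (x : R) :
  bernoulli_poly r n x =
  INR (fact n) *
  sum_f_R0 (fun k : nat =>
    sum_f_R0 (fun l : nat =>
      if Nat.even l then
        bernoulli_number r (n - k - l) /
        (INR (fact k) * INR (fact (n - k - l)) * 2 ^ (k + l) *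
         INR (fact (Nat.div2 l)))
      else 0) (n - k) * hermite k x) n.
Proof.
assert (H : has_expansion (fun t => Rpower (t / (exp t - 1)) r * exp (x * t))
  (PS_mult (fun k => (/ 2) ^ k * (hermite k x / INR (fact k)))
    (PS_mult (gauss_coeff (/ 4))
      (fun m => bernoulli_number r m / INR (fact m))))).
{ eapply has_expansion_ext;
    [|exact (has_expansion_mult _ _ _ _
        (has_expansion_half _ _ (has_expansion_hermite x))
        (has_expansion_mult _ _ _ _ (has_expansion_gauss (/ 4))
          (has_expansion_bernoulli_poly r 0)))].
  intros t _.
  (* The Gaussian exponent compensates the square coming from the Hermite function at [t / 2];
     [0 * t] is the exponent belonging to the Bernoulli numbers. *)
  replace (x * t) with
    ((2 * x * (/ 2 * t) - (/ 2 * t) ^ 2) + / 4 * t ^ 2 + 0 * t) by field.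
  rewrite 2!exp_plus; ring. }
assert (E := has_expansion_unique _ _ _ (has_expansion_bernoulli_poly r x) H n).
simpl in E.
replace (bernoulli_poly r n x)
  with (INR (fact n) * (bernoulli_poly r n x / INR (fact n)))
  by (field; apply INR_fact_neq_0).
rewrite E; f_equal; unfold PS_mult.
apply sum_eq; intros k _.
rewrite scal_sum, (Rmult_comm (sum_f_R0 _ _)), scal_sum.
apply sum_eq; intros l _; unfold gauss_coeff.
destruct (Nat.even l) eqn:El; [|ring].
rewrite (pow_quarter_div2 l El), pow_inv, pow_add.
field; repeat split; try apply INR_fact_neq_0; apply pow_nonzero; lra.
Qed.
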